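(* Consider a mixed-binary linear program (MBLP) with $m$ continuous variables $\mathbf{x}$ and $n$ binary variables $\mathbf{y}$, whose continuous relaxation has feasible region $Q=\{(\mathbf{x},\mathbf{y})\in\mathbb{R}^{m+n}: A'\binom{\mathbf{x}}{\mathbf{y}}\ge\mathbf{b}'\}$, and let (IOM) be the associated Ideal O'Matic problem defined in the context. Then the optimal objective value of (IOM) is zero if and only if the MBLP is ideal.
   Context: The MBLP is: minimize a linear objective subject to $A\binom{\mathbf{x}}{\mathbf{y}}\ge\mathbf{b}$, $\mathbf{x}\in\mathbb{R}^m$, $\mathbf{y}\in\{0,1\}^n$, with $A\in\mathbb{Q}^{k\times(m+n)}$ and $\mathbf{b}\in\mathbb{Q}^k$. Its continuous relaxation replaces $\mathbf{y}\in\{0,1\}^n$ by $\mathbf{0}\le\mathbf{y}\le\mathbf{1}$; the system $A'\binom{\mathbf{x}}{\mathbf{y}}\ge\mathbf{b}'$, with $A'\in\mathbb{R}^{k'\times(m+n)}$, $\mathbf{b}'\in\mathbb{R}^{k'}$, consists of $A\binom{\mathbf{x}}{\mathbf{y}}\ge\mathbf{b}$ together with the non-redundant ones among the bounds $\mathbf{0}\le\mathbf{y}\le\mathbf{1}$, so it describes exactly the relaxation's feasible region $Q$ (in particular $\mathbf{y}\in[0,1]^n$ on $Q$). An extreme point is a point of $Q$ that satisfies a linearly independent set of $m+n$ of the constraints at equality. The MBLP is ideal if and only if every extreme point $(\mathbf{x},\mathbf{y})$ of $Q$ satisfies $\mathbf{y}\in\{0,1\}^n$. Problem (IOM), in variables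 $\mathbf{x}\in\mathbb{R}^m$, $\mathbf{y}\in\mathbb{R}^n$, $\boldsymbol\phi\in\mathbb{R}^n$, $\boldsymbol\eta\in\{0,1\}^{k'}$: maximize $\sum_{r=1}^n\phi_r$ subject to $$\boldsymbol\phi\le2\mathbf{y},\quad \boldsymbol\phi\le\mathbf{2}-2\mathbf{y},\quad A'\tbinom{\mathbf{x}}{\mathbf{y}}\ge\mathbf{b}',\quad A'\tbinom{\mathbf{x}}{\mathbf{y}}\le\mathbf{b}'+M(\mathbf{1}-\boldsymbol\eta),$$ $$\sum_{r=1}^{k'}\eta_r=m+n,\qquad \sum_{r\in I}\eta_r\le|I|-1\ \text{ for all } I\in\mathcal{I},$$ where $\mathcal{I}$ is the collection of subsets $I\subseteq\{1,\dots,k'\}$ that correspond to linearly dependent sets of rows of the augmented matrix $(A'\mid\mathbf{b}')$. Here $M$ is a big-$M$ constant, taken sufficiently large that the constraint $A'\binom{\mathbf{x}}{\mathbf{y}}\le\mathbf{b}'+M(\mathbf{1}-\boldsymbol\eta)$ is deactivated in row $r$ when $\eta_r=0$; explicitly, $M\ge (A'z-\mathbf{b}')_r$ for every extreme point $z$ of $Q$ and every row $r$.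
   Formalization: The formal theorem additionally assumes that Q has at least one extreme point; otherwise (IOM) is infeasible and has no optimal value zero, while the MBLP is vacuously ideal, so the stated equivalence fails. *)

(* Defs.v *)
From HB Require Import structures.
From mathcomp Require Import all_boot all_order all_algebra.
From mathcomp Require Import reals.

Set Implicit Arguments.
Unset Strict Implicit.
Unset Printing Implicit Defensive.
Import Order.TTheory GRing.Theory Num.Theory.
Local Open Scope ring_scope.

Definition binary (R : nzRingType) (n : nat) (v : 'cV[R]_n) : Prop :=
  forall i, v i 0 = 0 \/ v i 0 = 1.

Definition rows_of (T : Type) (k N : nat) (I : {set 'I_k}) (A : 'M[T]_(k, N)) :
    'M[T]_(#|I|, N) :=
  rowsub (fun i : 'I_#|I| => enum_val i) A.

(* Independence is that of the indexed family of rows: two equal rows with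
   distinct indices are dependent. *)
Definition independent_rows (F : fieldType) (k N : nat) (A : 'M[F]_(k, N))
    (I : {set 'I_k}) : bool :=
  row_free (rows_of I A).

Definition polyhedron (R : realType) (k N : nat)
    (A : 'M[R]_(k, N)) (b : 'cV[R]_k) (z : 'cV[R]_N) : Prop :=
  forall r, b r 0 <= (A *m z) r 0.

Definition extreme_point (R : realType) (k N : nat)
    (A : 'M[R]_(k, N)) (b : 'cV[R]_k) (z : 'cV[R]_N) : Prop :=
  polyhedron A b z /\
  exists I : {set 'I_k},
    [/\ #|I| = N, independent_rows A I
      & forall r, r \in I -> (A *m z) r 0 = b r 0].

(* minimize obj *m col_mx x y subject to lhs *m col_mx x y >= rhs, with x real
   and y binary. *)
Record mblp (R : realType) (m n k : nat) := MBLP {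
  mblp_obj : 'rV[R]_(m + n);
  mblp_lhs : 'M[rat]_(k, m + n);
  mblp_rhs : 'cV[rat]_k
}.

Section Relaxation.
Variables (R : realType) (m n k : nat) (P : mblp R m n k).

Let A : 'M[R]_(k, m + n) := map_mx (@ratr R) (mblp_lhs P).
Let b : 'cV[R]_k := map_mx (@ratr R) (mblp_rhs P).

Definition relaxation (z : 'cV[R]_(m + n)) : Prop :=
  polyhedron A b z /\ forall i : 'I_n, 0 <= dsubmx z i 0 <= 1.

(* The 2n bounds in >= form: row lshift n i is y_i >= 0 and row rshift n i is
   - y_i >= - 1. *)
Definition bounds_lhs : 'M[R]_(n + n, m + n) :=
  col_mx (row_mx 0 1%:M) (row_mx 0 (- 1%:M)).
Definition bounds_rhs : 'cV[R]_(n + n) := col_mx 0 (const_mx (- 1)).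

(* The system A' z >= b' obtained by keeping the bounds indexed by J. *)
Definition system_lhs (J : {set 'I_(n + n)}) : 'M[R]_(k + #|J|, m + n) :=
  col_mx A (rows_of J bounds_lhs).
Definition system_rhs (J : {set 'I_(n + n)}) : 'cV[R]_(k + #|J|) :=
  col_mx b (rows_of J bounds_rhs).

(* Redundancy of a bound may be understood relative to A z >= b alone or to all
   the other retained constraints, and in the latter case J need not be unique.
   The two conditions hold for every J selected in either sense. *)
Definition nonredundant_bounds (J : {set 'I_(n + n)}) : Prop :=
  (forall z, polyhedron (system_lhs J) (system_rhs J) z <-> relaxation z) /\
  (forall j, j \in J ->
     exists2 z, polyhedron A b z & (bounds_lhs *m z) j 0 < bounds_rhs j 0).

Definition ideal (J : {set 'I_(n + n)}) : Prop :=
  forall (x : 'cV[R]_m) (y : 'cV[R]_n),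
    extreme_point (system_lhs J) (system_rhs J) (col_mx x y) -> binary y.

End Relaxation.

Definition big_M (R : realType) (k N : nat)
    (A : 'M[R]_(k, N)) (b : 'cV[R]_k) (M : R) : Prop :=
  forall z, extreme_point A b z -> forall r, (A *m z - b) r 0 <= M.

Section IOM.
Variables (R : realType) (m n k : nat).
Variables (A : 'M[R]_(k, m + n)) (b : 'cV[R]_k) (M : R).

Record iom_feasible (x : 'cV[R]_m) (y phi : 'cV[R]_n) (eta : 'cV[R]_k) :
    Prop := IOMFeasible {
  iom_phi_le_2y : forall i, phi i 0 <= 2 * y i 0;
  iom_phi_le_2_2y : forall i, phi i 0 <= 2 - 2 * y i 0;
  iom_system : forall r, b r 0 <= (A *m col_mx x y) r 0;
  iom_tight : forall r, (A *m col_mx x y) r 0 <= b r 0 + M * (1 - eta r 0);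
  iom_card : \sum_r eta r 0 = (m + n)%:R;
  iom_dependent : forall I : {set 'I_k}, ~~ independent_rows (row_mx A b) I ->
    \sum_(r in I) eta r 0 <= #|I|%:R - 1;
  iom_binary : binary eta
}.

Definition iom_objective (phi : 'cV[R]_n) : R := \sum_i phi i 0.

(* v is the attained maximum; an infeasible problem has no optimal value. *)
Definition iom_optimal_value (v : R) : Prop :=
  (exists x y phi eta, iom_feasible x y phi eta /\ iom_objective phi = v) /\
  (forall x y phi eta, iom_feasible x y phi eta -> iom_objective phi <= v).

End IOM.

(* Main.v *)
Require Import Defs.
From HB Require Import structures.
From mathcomp Require Import all_boot all_order all_algebra.
From mathcomp Require Import reals lra.
Import Order.TTheory GRing.Theory Num.Theory.
Local Open Scope ring_scope.

(** The feasible [eta] are the indicators of sets of [m + n] rows of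
    [(A' | b')] that are independent and tight at [z = (x, y)]. Tightness means
    [b'_I = A'_I z], so [(A' | b')_I] factors through [A'_I] and independence of
    the augmented rows is that of the rows of [A']. Hence the feasible [(x, y)]
    are the extreme points, and the best [phi] at such a point is
    [phi_i = min (2 y_i) (2 - 2 y_i)], which is nonnegative on [0, 1] and
    vanishes only at [0] and [1]. *)

Lemma row_free_rowsub {F : fieldType} {p q N : nat} {f : 'I_p -> 'I_q}
    {A : 'M[F]_(q, N)} :
  injective f -> row_free A -> row_free (rowsub f A).
Proof.
move=> f_inj /row_freeP[B AB1]; apply/row_freeP.
(* This keeps the columns of the right inverse [B] indexed by [f]; injectivity of [f] makes the
   selected block of the identity an identity again. *)
exists (B *m (rowsub f 1%:M)^T); rewrite mulmxA mul_rowsub_mx AB1.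
apply/matrixP=> i j; rewrite mul_rowsub_mx mul1mx !mxE.
by rewrite (inj_eq f_inj) eq_sym.
Qed.

Lemma independent_rowsS {F : fieldType} {k N : nat} {A : 'M[F]_(k, N)}
    {I I' : {set 'I_k}} :
  I' \subset I -> independent_rows A I -> independent_rows A I'.
Proof.
move=> /subsetP sub indI.
have mem (i : 'I_#|I'|) : enum_val i \in I by apply/sub/enum_valP.
pose g (i : 'I_#|I'|) : 'I_#|I| := enum_rank_in (mem i) (enum_val i).
have gK i : enum_val (g i) = enum_val i by rewrite /g enum_rankK_in.
have g_inj : injective g.
  by move=> i j eq_g; apply: enum_val_inj; rewrite -gK eq_g gK.
rewrite /independent_rows; have -> : rows_of I' A = rowsub g (rows_of I A).
  by apply/matrixP=> i j; rewrite !mxE gK.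
exact: row_free_rowsub.
Qed.

Lemma independent_rows_row_mx {F : fieldType} {k N p : nat}
    {A : 'M[F]_(k, N)} {B : 'M[F]_(k, p)} {I : {set 'I_k}} :
  independent_rows A I -> independent_rows (row_mx A B) I.
Proof.
move=> /row_freeP[C AC1]; apply/row_freeP; exists (col_mx C 0).
have -> : rows_of I (row_mx A B) = row_mx (rows_of I A) (rows_of I B).
  by apply/matrixP=> i j; rewrite !mxE; case: split => l; rewrite mxE.
by rewrite mul_row_col mulmx0 addr0.
Qed.

Lemma independent_rows_tight {F : fieldType} {k N : nat} {A : 'M[F]_(k, N)}
    {b : 'cV[F]_k} {z : 'cV[F]_N} {I : {set 'I_k}} :
  (forall r, r \in I -> (A *m z) r 0 = b r 0) ->
  independent_rows (row_mx A b) I = independent_rows A I.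
Proof.
move=> tight; apply/idP/idP; last exact: independent_rows_row_mx.
rewrite /independent_rows.
have -> : rows_of I (row_mx A b) = rows_of I A *m row_mx 1%:M z.
  rewrite mul_mx_row mulmx1 mul_rowsub_mx; apply/matrixP=> i j.
  rewrite [LHS]mxE [LHS]mxE [RHS]mxE; case: split => l; rewrite [RHS]mxE //.
  by rewrite !ord1 tight // enum_valP.
move=> /row_freeP[C AC1]; apply/row_freeP.
by exists (row_mx 1%:M z *m C); rewrite mulmxA.
Qed.

Section Feasibility.
Context {R : realType} {m n k : nat}.
Context {A : 'M[R]_(k, m + n)} {b : 'cV[R]_k} {M : R}.

Lemma iom_feasible_extreme {x y phi eta} :
  iom_feasible A b M x y phi eta -> extreme_point A b (col_mx x y).
Proof.
case=> _ _ sys tight card dep bin.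
split=> //; pose I := [set r | eta r 0 == 1].
have etaE r : eta r 0 = (r \in I)%:R.
  by rewrite inE; case: (bin r) => ->; rewrite ?eqxx // eq_sym oner_eq0.
have sumI : \sum_(r in I) eta r 0 = #|I|%:R.
  by rewrite -sum1_card natr_sum; apply: eq_bigr => r rI; rewrite etaE rI.
have tightI r : r \in I -> (A *m col_mx x y) r 0 = b r 0.
  move=> rI; apply/le_anti; rewrite sys andbT.
  by have := tight r; rewrite etaE rI subrr mulr0 addr0.
exists I; split=> //.
- apply/eqP; rewrite -(eqr_nat R) -card -sumI big_mkcond /=.
  by apply/eqP/eq_bigr => r _; rewrite etaE; case: (r \in I).
(* If [I] were dependent, its own cut would give [#|I| <= #|I| - 1]. *)
- rewrite -(independent_rows_tight tightI); apply/negPn/negP => /dep.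
  by rewrite sumI; lra.
Qed.

(** The witness [eta] is the indicator of the tight independent rows at the extreme point. It does
    not involve [phi], which stays free so that both the largest admissible [phi] and [phi = 0] can
    be used later. *)
Lemma extreme_iom_feasible {x y} (phi : 'cV[R]_n) :
    big_M A b M -> extreme_point A b (col_mx x y) ->
    (forall i, phi i 0 <= 2 * y i 0) ->
    (forall i, phi i 0 <= 2 - 2 * y i 0) ->
  exists eta, iom_feasible A b M x y phi eta.
Proof.
move=> hM ext phi1 phi2; have [sys [I [cardI indI tightI]]] := ext.
have sum_ind (I' : {set 'I_k}) :
    \sum_(r in I') (r \in I)%:R = #|I' :&: I|%:R :> R.
  rewrite -sum1_card natr_sum big_mkcond [RHS]big_mkcond /=.
  by apply: eq_bigr => r _; rewrite inE; case: (r \in I'); case: (r \in I).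
exists (\col_r (r \in I)%:R); split=> //.
- move=> r; rewrite [X in 1 - X]mxE; have [rI|_] := boolP (r \in I).
    by rewrite tightI // subrr mulr0 addr0.
  (* Outside [I] the slack of row [r] at this extreme point is at most [M]. *)
  have := hM _ ext r; rewrite [(_ - b) r 0]mxE [(- b) r 0]mxE.
  by rewrite mulr0n subr0 mulr1 lerBlDl.
- rewrite -cardI -[I in RHS]setTI -sum_ind.
  by apply: eq_big => r; rewrite ?inE ?mxE.
- move=> I' dep; under eq_bigr do rewrite mxE.
  rewrite sum_ind lerBrDr natr1 ler_nat.
  (* A dependent [I'] cannot lie inside the independent [I], so it loses at least one row when
     intersected with [I]: this is the [- 1] of the cut. *)
  apply/proper_card/properIl/(contra _ dep) => sub.
  exact/(independent_rowsS sub)/independent_rows_row_mx.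
- by move=> r; rewrite mxE; case: (r \in I); [right|left].
Qed.

End Feasibility.

(** [hQ] makes (IOM) feasible: with no extreme point, idealness would hold vacuously while (IOM) had
    no optimal value. *)
Theorem proposition1 (R : realType) (m n k : nat) (P : mblp R m n k)
    (J : {set 'I_(n + n)}) (M : R)
    (hJ : nonredundant_bounds P J)
    (hM : big_M (system_lhs P J) (system_rhs P J) M)
    (hQ : exists z, extreme_point (system_lhs P J) (system_rhs P J) z) :
  iom_optimal_value (system_lhs P J) (system_rhs P J) M 0 <-> ideal P J.
Proof.
have y01 x y : extreme_point (system_lhs P J) (system_rhs P J) (col_mx x y) ->
    forall i, 0 <= y i 0 <= 1.
  move=> [/hJ.1[_ bnd] _] i; have := bnd i.
  by rewrite col_mxKd.
split=> [[_ opt] x y ext i | idl].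
- pose phi : 'cV[R]_n := \col_j Num.min (2 * y j 0) (2 - 2 * y j 0).
  have [|j|eta feas] := extreme_iom_feasible phi hM ext.
  + by move=> j; rewrite mxE ge_min lexx.
  + by rewrite mxE ge_min lexx orbT.
  have phi_ge0 j : 0 <= phi j 0.
    by have := y01 _ _ ext j; rewrite mxE le_min; lra.
  have /eqP : iom_objective phi = 0.
    by apply/le_anti; rewrite (opt _ _ _ _ feas) sumr_ge0.
  rewrite psumr_eq0 // => /allP /(_ i (mem_index_enum i)) /= /eqP.
  rewrite mxE; case: leP => _ phi0; [left|right]; lra.
- split=> [|x y phi eta feas].
    (* The value 0 is attained: [phi = 0] is admissible at any extreme point, because [y] lies in
       the unit box. *)
    have [z] := hQ; rewrite -[z]vsubmxK; set x := usubmx z; set y := dsubmx z.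
    move=> ext; have bnd := y01 _ _ ext.
    have [|i|eta feas] := extreme_iom_feasible 0 hM ext.
    + by move=> i; rewrite [leLHS]mxE; have := bnd i; lra.
    + by rewrite [leLHS]mxE; have := bnd i; lra.
    exists x, y, 0, eta; split=> //.
    by apply: big1 => i _; rewrite mxE.
  (* At a binary [y], one of the two upper bounds on each [phi i 0] is zero. *)
  apply: sumr_le0 => i _.
  have := iom_phi_le_2y feas i; have := iom_phi_le_2_2y feas i.
  by case: (idl _ _ (iom_feasible_extreme feas) i) => ->; lra.
Qed.
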